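(* Let $\mathcal{A}$ be a unital $C^*$-algebra, $a\in \mathcal{A}$ and $f\in S(\mathcal{A})$. Then $$|f(a)|^r \leq \frac{1}{2} f(|a|^r+ |a^*|^r) \quad \text{ for all } r=1,2,\ldots.$$ Moreover, for all $r=1,2,\ldots$, $$v^r(a) \leq \frac{1}{2} \left\| |a|^r+|a^*|^r \right\|.$$ In particular, for $r=1$, $$v(a) \leq \frac{1}{2} \left\| |a|+|a^*| \right\| \leq \frac{1}{2} \left\| a \right\|+ \frac{1}{2} \sqrt{\left\| a^2 \right\|}.$$
   Context: $\mathcal{A}$ is a unital $C^*$-algebra with unit $e$. $S(\mathcal{A})$ is the set of normalized states, i.e. continuous linear functionals $f$ on $\mathcal{A}$ with $f(e)=\|f\|=1$ (equivalently, positive linear functionals with $f(e)=1$). The algebraic numerical radius of $a$ is $v(a)=\sup\{|f(a)|: f\in S(\mathcal{A})\}$, and $v^r(a)$ means $(v(a))^r$. $|a|=(a^*a)^{1/2}$, so $|a^*|=(aa^* )^{1/2}$. *)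

(* Defs.v *)
From HB Require Import structures.
From mathcomp Require Import all_boot all_order all_algebra.
From mathcomp Require Import complex.
From mathcomp Require Import all_classical all_reals.

Set Implicit Arguments.
Unset Strict Implicit.
Unset Printing Implicit Defensive.

Import Order.TTheory GRing.Theory Num.Theory.

Local Open Scope classical_set_scope.
Local Open Scope ring_scope.
Local Open Scope complex_scope.

(* Unital complex C*-algebras; an [algType] is nonzero, i.e. [1 != 0].
   The norm is a mixin field rather than that of a [normedModType R[i]]:
   Hierarchy-Builder accepts no structure joining rings and normed Z-modules
   other than [numDomainType].  It also makes the norm real-valued, as suprema
   require.  [normc] is the real-valued modulus on [R[i]]. *)
HB.mixin Record isCStarAlgebra (R : realType) A of GRing.Algebra R[i] A := {
  cnorm : A -> R ;
  star : A -> A ;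
  cnorm_eq0 : forall x, cnorm x = 0 -> x = 0 ;
  cnormD : forall x y, cnorm (x + y) <= cnorm x + cnorm y ;
  cnormZ : forall (k : R[i]) x, cnorm (k *: x) = Normc.normc k * cnorm x ;
  cnormM : forall x y, cnorm (x * y) <= cnorm x * cnorm y ;
  cnorm_complete : forall u : nat -> A,
    (forall e : R, 0 < e -> exists N : nat, forall m n : nat,
       (N <= m)%N -> (N <= n)%N -> cnorm (u m - u n) < e) ->
    exists l : A, forall e : R, 0 < e -> exists N : nat, forall n : nat,
       (N <= n)%N -> cnorm (u n - l) < e ;
  starK : involutive star ;
  starD : {morph star : x y / x + y} ;
  starZ : forall (k : R[i]) x, star (k *: x) = conjc k *: star x ;
  starM : forall x y, star (x * y) = star y * star x ;
  cnorm_starM : forall x, cnorm (star x * x) = cnorm x ^+ 2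
}.

#[short(type="cstarAlgType")]
HB.structure Definition CStarAlgebra (R : realType) :=
  {A of GRing.Algebra R[i] A & isCStarAlgebra R A}.

Section CStar.
Context {R : realType} {A : cstarAlgType R}.
Implicit Types (a b x y : A) (f : {scalar A}).

Definition invertible x := exists y, x * y = 1 /\ y * x = 1.

Definition spectrum a : set R[i] := [set l | ~ invertible (l%:A - a)].

(* On [R[i]], [0 <= l] means that [l] is real and nonnegative. *)
Definition positive a := star a = a /\ spectrum a `<=` [set l | 0 <= l].

(* The unique positive square root of [a] when [a] is positive; [xget] returns
   [0] if there is none. *)
Definition sqrtA a : A := xget 0 [set b | positive b /\ b ^+ 2 = a].

Definition absA a : A := sqrtA (star a * a).

Definition continuousA f := forall (x : A) (e : R), 0 < e ->
  exists2 d : R, 0 < d &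
    forall y, cnorm (y - x) < d -> Normc.normc (f y - f x) < e.

Definition dualnorm f : R :=
  sup [set Normc.normc (f x) | x in [set x : A | cnorm x <= 1]].

Definition state : set {scalar A} :=
  [set f | [/\ continuousA f, f 1 = 1 & dualnorm f = 1]].

Definition numradius a : R := sup [set Normc.normc (f a) | f in state].

End CStar.

(* Main.v *)
(** The proof stays inside the algebra: no characters and no representations.

    Call [h] [npositive] if it is self-adjoint and [|t - h| <= t] for some
    real [t >= 0].  The iteration [y := (x + y^2) / 2] converges to
    [1 - sqrt (1 - x)] when [|x| <= 1], which gives square roots of [npositive]
    elements.  If [s] and [m] are commuting self-adjoint elements with
    [s^2 + m^2 = 1], then [s + i m] is unitary, so [|s| <= 1]; hence squares of
    self-adjoint elements are [npositive], and [npositive] coincides with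
    spectral positivity.  Kaplansky's argument then shows that [a^* a] is
    positive.

    With [p = |a|] and [q = |a^*|] one has [a p = q a], and the Cauchy-Schwarz
    inequality for [f] applied to [a = (a (p + e)^(-1/2)) (p + e)^(1/2)] yields
    [|f a|^2 <= f(p) f(q)] as [e] tends to [0].  Since [n |-> f(p^n)] is
    log-convex, [f(p)^r <= f(p^r)], and the first bound follows by AM-GM.

    For the last bound write [p = s^2] and [q = t^2]: expanding [(s^2 + t^2)^n]
    into words gives [|p + q| <= |a| + |s t|], and similarly
    [|s t|^2 = |t p t| <= |q p| = |a^2|]. *)

Require Import Defs.
From HB Require Import structures.
From mathcomp Require Import all_boot all_order all_algebra.
From mathcomp Require Import complex.
From mathcomp Require Import all_classical all_reals.
From mathcomp Require Import ring lra.
Import Order.TTheory GRing.Theory Num.Theory.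
Local Open Scope ring_scope.
Local Open Scope complex_scope.

(** * Norm, involution and convergence *)

Section Norm.
Set Implicit Arguments.
Unset Strict Implicit.
Context {R : realType} {A : cstarAlgType R}.
Implicit Types (a b x y z : A) (u : nat -> A).

Lemma normcR (t : R) : Normc.normc t%:C = `|t|.
Proof. by rewrite /= expr0n addr0 sqrtr_sqr. Qed.

Lemma cnorm0 : cnorm (0 : A) = 0.
Proof. by rewrite -[X in cnorm X](scale0r (0 : A)) cnormZ Normc.normc0 mul0r. Qed.

Lemma cnormN x : cnorm (- x) = cnorm x.
Proof.
have := cnormZ (-1)%:C x.
by rewrite normcR normrN1 mul1r rmorphN rmorph1 scaleN1r.
Qed.

Lemma cnorm_ge0 x : 0 <= cnorm x.
Proof. by have := cnormD x (- x); rewrite subrr cnorm0 cnormN; lra. Qed.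

Lemma cnormZR (t : R) x : cnorm (t%:C *: x) = `|t| * cnorm x.
Proof. by rewrite cnormZ normcR. Qed.

Lemma cnorm_distC x y : cnorm (x - y) = cnorm (y - x).
Proof. by rewrite -cnormN opprB. Qed.

Lemma cnormB x y : cnorm (x - y) <= cnorm x + cnorm y.
Proof. by rewrite -(cnormN y) cnormD. Qed.

Lemma star0 : star (0 : A) = 0.
Proof. by have /eqP := starD (0 : A) 0; rewrite addr0 addrC -subr_eq subrr => /eqP. Qed.

Lemma starN x : star (- x) = - star x.
Proof. by apply/eqP; rewrite -addr_eq0 -starD addNr star0. Qed.

Lemma starB x y : star (x - y) = star x - star y.
Proof. by rewrite starD starN. Qed.

Lemma star1 : star (1 : A) = 1.
Proof. by rewrite -[LHS]mul1r -[X in X * _]starK -starM mul1r starK. Qed.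

Lemma starZR (t : R) x : star (t%:C *: x) = t%:C *: star x.
Proof. by rewrite starZ conjc_real. Qed.

Lemma starX x n : star (x ^+ n) = star x ^+ n.
Proof. by elim: n => [|n IH]; rewrite ?expr0 ?star1 // exprS exprSr starM IH. Qed.

Lemma star_scalar (t : R) : star (t%:C%:A : A) = t%:C%:A.
Proof. by rewrite starZR star1. Qed.

Lemma cnorm_star x : cnorm (star x) = cnorm x.
Proof.
wlog lt: x / cnorm (star x) < cnorm x => [H|].
  case: (ltgtP (cnorm (star x)) (cnorm x)) => // h; first exact: H.
  by have := H (star x); rewrite starK => /(_ h).
have := cnormM (star x) x; rewrite cnorm_starM expr2.
have := cnorm_ge0 (star x) => h0; have h1 : 0 < cnorm x by lra.
by rewrite ler_pM2r //; lra.
Qed.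

Lemma cnorm_mulstar x : cnorm (x * star x) = cnorm x ^+ 2.
Proof. by rewrite -{1}(starK x) cnorm_starM cnorm_star. Qed.

Lemma cnorm1 : cnorm (1 : A) = 1.
Proof.
have := cnorm_starM (1 : A); rewrite star1 mul1r => h.
have h0 : cnorm (1 : A) != 0 by apply/eqP => /cnorm_eq0 /eqP; rewrite oner_eq0.
by apply: (mulfI h0); rewrite mulr1 -expr2 -h.
Qed.

Lemma cnorm_scalar (t : R) : cnorm (t%:C%:A : A) = `|t|.
Proof. by rewrite cnormZR cnorm1 mulr1. Qed.

Lemma cnormX x n : cnorm (x ^+ n) <= cnorm x ^+ n.
Proof.
elim: n => [|n IH]; first by rewrite !expr0 cnorm1.
by rewrite !exprS (le_trans (cnormM _ _)) // ler_wpM2l // cnorm_ge0.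
Qed.

Lemma star_mul_eq0 x : star x * x = 0 -> x = 0.
Proof.
move=> h; apply: cnorm_eq0; apply/eqP.
by have /esym/eqP := cnorm_starM x; rewrite h cnorm0 expf_eq0.
Qed.

Definition cvgA u l := forall e : R, 0 < e ->
  exists N : nat, forall n : nat, (N <= n)%N -> cnorm (u n - l) < e.

(** Telescoping bounds each distance between terms of [u] by the corresponding increment of [eta].
    So [eta] is nondecreasing, and past an index where it is within [e] of its supremum all
    distances are below [e]. *)
Lemma majorized_cvg u (eta : nat -> R) M :
    (forall n, cnorm (u n.+1 - u n) <= eta n.+1 - eta n) ->
    (forall n, eta n <= M) ->
  exists l, cvgA u l.
Proof.
move=> hu hM; apply: cnorm_complete => e e0.
have diff m n : (n <= m)%N -> cnorm (u m - u n) <= eta m - eta n.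
  elim: m => [|m IH]; first by rewrite leqn0 => /eqP->; rewrite !subrr cnorm0.
  rewrite leq_eqVlt => /orP[/eqP->|]; first by rewrite !subrr cnorm0.
  rewrite ltnS => /IH h; have := cnormD (u m.+1 - u m) (u m - u n).
  rewrite addrA subrK; have := hu m; lra.
have mono m n : (n <= m)%N -> eta n <= eta m.
  by move=> /diff; have := cnorm_ge0 (u m - u n); lra.
pose S := [set eta n | n in [set: nat]]%classic.
have hS : has_sup S by split; [exists (eta 0%N), 0%N | exists M => _ [n _ <-]].
have [_ [N _ <-] hN] := sup_adherent e0 hS.
have hsup n : eta n <= sup S by apply: sup_upper_bound => //; exists n.
exists N => m n; wlog nm : m n / (n <= m)%N => [H Nm Nn|_ Nn].
  by case: (leqP n m) => [|/ltnW] nm; [|rewrite cnorm_distC]; apply: H.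
have := diff _ _ nm; have := mono _ _ Nn; have := hsup m; lra.
Qed.

(** This passes identities to the limit without continuity lemmas: [x] is the defect of the identity
    at [l]. Two consecutive terms appear because a fixed-point equation involves [u n] and
    [u n.+1]. *)
Lemma cvgA_eq0 u l x (K : R) : cvgA u l ->
  (forall n, cnorm x <= K * (cnorm (u n - l) + cnorm (u n.+1 - l))) -> x = 0.
Proof.
move=> ul hx; apply: cnorm_eq0; apply/eqP; rewrite eq_le cnorm_ge0 andbT.
rewrite leNgt; apply/negP => x0.
have K0 : 0 < K.
  rewrite ltNge; apply/negP => K0; have := hx 0%N.
  have := cnorm_ge0 (u 0%N - l); have := cnorm_ge0 (u 1%N - l); nra.
have [|N hN] := ul (cnorm x / K / 2); first by rewrite !divr_gt0.
have := hN _ (leqnn N); have := hN _ (leqnSn N); have := hx N.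
rewrite -ler_pdivrMl //; lra.
Qed.

Lemma cvgA_le u l x (c : R) : cvgA u l ->
  (forall n, cnorm (u n - x) <= c) -> cnorm (l - x) <= c.
Proof.
move=> ul h; rewrite leNgt; apply/negP => lt.
have [|N hN] := ul (cnorm (l - x) - c); first by rewrite subr_gt0.
have := cnormB (u N - x) (u N - l); rewrite opprB addrC subrKA.
have := hN _ (leqnn N); have := h N; lra.
Qed.

Lemma cvgA_comm u l z : cvgA u l ->
  (forall n, GRing.comm z (u n)) -> GRing.comm z l.
Proof.
move=> ul h; apply/eqP; rewrite -subr_eq0; apply/eqP.
apply: (cvgA_eq0 ul (K := cnorm z + cnorm z)) => n.
have -> : z * l - l * z = (u n - l) * z - z * (u n - l).
  by rewrite mulrBl mulrBr opprB (h n) [RHS]addrC subrKA.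
have := cnormB ((u n - l) * z) (z * (u n - l)).
have := cnormM (u n - l) z; have := cnormM z (u n - l).
have := cnorm_ge0 z; have := cnorm_ge0 (u n.+1 - l); nra.
Qed.

Lemma cvgA_star u l : cvgA u l -> (forall n, star (u n) = u n) -> star l = l.
Proof.
move=> ul h; apply/eqP; rewrite -subr_eq0; apply/eqP.
apply: (cvgA_eq0 ul (K := 2)) => n.
have -> : star l - l = (u n - l) - star (u n - l).
  by rewrite starB h opprB [RHS]addrC addrA subrK.
have := cnormB (u n - l) (star (u n - l)); rewrite cnorm_star.
have := cnorm_ge0 (u n.+1 - l); lra.
Qed.

(** The partial sums of the geometric series are the iterates of [y := 1 + x * y]. The same
    iteration with [r] for [x] majorizes them and stays below [(1 - r)^-1]. *)
Lemma Neumann x : cnorm x < 1 -> invertible (1 - x).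
Proof.
move=> x1; set r := cnorm x in x1; have r0 : 0 <= r by exact: cnorm_ge0.
pose u n := iter n (fun y => 1 + x * y) 0.
pose eta n := iter n (fun t => 1 + r * t) (0 : R).
have [|n|z uz] := @majorized_cvg u eta ((1 - r)^-1).
- elim=> [|n IH]; first by rewrite /= mulr0 addr0 !subr0 mulr0 addr0 cnorm1.
  have -> : u n.+2 - u n.+1 = x * (u n.+1 - u n).
    by rewrite mulrBr /= -/(u n.+1) (addrC 1 (x * _)) addrKA.
  have -> : eta n.+2 - eta n.+1 = r * (eta n.+1 - eta n) by rewrite /=; ring.
  by rewrite (le_trans (cnormM _ _)) // ler_wpM2l.
- rewrite -div1r ler_pdivlMr; last by lra.
  by elim: n => [|n IH] /=; [lra|nra].
have xz : GRing.comm x z.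
  apply: (cvgA_comm uz); elim=> [|n IH] /=; first exact: commr0.
  by apply: commrD; [exact: commr1|apply: commrM].
have /eqP : z - (1 + x * z) = 0.
  apply: (cvgA_eq0 uz (K := 1 + r)) => n.
  have -> : z - (1 + x * z) = x * (u n - z) - (u n.+1 - z).
    by rewrite mulrBr opprB [RHS]addrC [u n.+1]/= -/(u n) !opprD !addrA subrK.
  have := cnormB (x * (u n - z)) (u n.+1 - z); have := cnormM x (u n - z).
  have := mulr_ge0 r0 (cnorm_ge0 (u n.+1 - z)); have := cnorm_ge0 (u n - z).
  rewrite -/r; lra.
rewrite subr_eq0 => /eqP ez; exists z; rewrite mulrBl mulrBr -xz mul1r mulr1.
by rewrite {1 3}ez addrK.
Qed.

End Norm.

(** * Square roots and positivity *)

Section Positivity.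
Set Implicit Arguments.
Unset Strict Implicit.
Context {R : realType} {A : cstarAlgType R}.
Implicit Types (a b g h k m s x y z : A) (t c : R).

Lemma algR_comm x (l : R[i]) : GRing.comm x (l%:A).
Proof. by rewrite /GRing.comm mulr_algl mulr_algr. Qed.

Lemma commZ x y (l : R[i]) : GRing.comm x y -> GRing.comm x (l *: y).
Proof. by move=> h; rewrite /GRing.comm -scalerAl -scalerAr h. Qed.

Lemma scalec2 x : 2%:C *: x = x + x.
Proof. by rewrite rmorphD rmorph1 scalerDl scale1r. Qed.

Lemma inv_lr x y z : x * y = 1 -> z * x = 1 -> invertible x.
Proof.
move=> xy zx; exists y; split=> //.
by rewrite -[y in LHS]mul1r -zx -(mulrA z) xy mulr1.
Qed.

Lemma inv_comm x y z : x * y = 1 -> y * x = 1 -> GRing.comm z x -> GRing.comm z y.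
Proof.
move=> xy yx zx; rewrite /GRing.comm -[LHS]mul1r -yx -!mulrA (mulrA x) -zx.
by rewrite -mulrA xy mulr1.
Qed.

Lemma inv_star x y : x * y = 1 -> y * x = 1 -> star x = x -> star y = y.
Proof.
move=> xy yx sx; have h : x * star y = 1 by rewrite -{1}sx -starM yx star1.
by rewrite -[LHS]mul1r -yx -mulrA h mulr1.
Qed.

Lemma invertibleZ (l : R[i]) x : l != 0 -> invertible x -> invertible (l *: x).
Proof.
move=> l0 [y [xy yx]]; exists (l^-1 *: y).
by rewrite -!scalerAl -!scalerAr !scalerA divff // mulVf // xy yx scale1r.
Qed.

Lemma invertibleN x : invertible x -> invertible (- x).
Proof. by move=> [y [xy yx]]; exists (- y); rewrite !mulrNN. Qed.

Lemma invertible_factor x y : invertible (x * y) -> GRing.comm x y -> invertible x.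
Proof.
move=> [z [h1 h2]] xy; apply: (@inv_lr x (y * z) (z * y)); first by rewrite mulrA.
by rewrite -mulrA -xy.
Qed.

(** The iterates are majorized by those of the scalar iteration with 1 in place of [x], which stay
    in [0, 1]. The limit [y] satisfies [y + y = x + y * y], that is, [(1 - y)^2 = 1 - x]. Everything
    commuting with [x] commutes with the iterates, hence with [y]. *)
Lemma sqrt_near1 x : star x = x -> cnorm x <= 1 ->
  exists s, [/\ star s = s, cnorm (1 - s) <= 1, s * s = 1 - x &
    forall z, GRing.comm z x -> GRing.comm z s].
Proof.
move=> sx x1; pose half : R := 2^-1; have half0 : 0 <= half by rewrite /half; lra.
pose u n := iter n (fun y => half%:C *: (x + y * y)) 0.
pose eta n := iter n (fun t => half * (1 + t * t)) (0 : R).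
have eta01 n : 0 <= eta n <= 1.
  by elim: n => [|n /=]; rewrite ?lexx ?ler01 // -/(eta n) /half; nra.
have comm_u z : GRing.comm z x -> forall n, GRing.comm z (u n).
  move=> zx; elim=> [|n IH]; first exact: commr0.
  by apply: commZ; apply: commrD => //; apply: commrM.
have ule n : cnorm (u n) <= eta n.
  elim: n => [|n IH] /=; first by rewrite cnorm0.
  rewrite cnormZR ger0_norm // ler_wpM2l // (le_trans (cnormD _ _)) // lerD //.
  by rewrite (le_trans (cnormM _ _)) // ler_pM // cnorm_ge0.
have usq n v : u n * u n - v * v = u n * (u n - v) + (u n - v) * v.
  by rewrite mulrBl mulrBr addrA subrK.
have [|n|y uy] := @majorized_cvg _ _ u eta 1.
- elim=> [|n IH].
    by rewrite /= mulr0 addr0 !subr0 mulr0 addr0 mulr1 cnormZR ger0_norm // ler_piMr.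
  have -> : u n.+2 - u n.+1 = half%:C *: ((u n.+1 - u n) * (u n.+1 + u n)).
    rewrite /= -/(u n) -/(u n.+1) -scalerBr (addrC x) addrKA; congr (_ *: _).
    have cu : GRing.comm (u n.+1) (u n).
      by apply/comm_u/commr_sym/comm_u.
    by rewrite mulrBl !mulrDr opprD addrA -cu addrK.
  have -> : eta n.+2 - eta n.+1 = half * ((eta n.+1 - eta n) * (eta n.+1 + eta n)).
    by rewrite /= -/(eta n) -/(eta n.+1); ring.
  rewrite cnormZR ger0_norm // ler_wpM2l // (le_trans (cnormM _ _)) //.
  by rewrite ler_pM ?cnorm_ge0 // (le_trans (cnormD _ _)) // lerD.
- by have /andP[] := eta01 n.
have y1 : cnorm y <= 1.
  rewrite -(subr0 y); apply: (cvgA_le uy) => n; rewrite subr0.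
  by have := ule n; have := eta01 n; lra.
have sy : star y = y.
  apply: (cvgA_star uy); elim=> [|n IH]; first exact: star0.
  by rewrite /= -/(u n) starZR starD starM sx IH.
have comm_y z : GRing.comm z x -> GRing.comm z y.
  by move=> zx; apply: (cvgA_comm uy) => n; apply: comm_u.
have /eqP : y - half%:C *: (x + y * y) = 0.
  apply: (cvgA_eq0 uy (K := 1)) => n.
  have -> : y - half%:C *: (x + y * y) =
      half%:C *: (u n * u n - y * y) - (u n.+1 - y).
    by rewrite opprB [RHS]addrC /= -/(u n) scalerBr !scalerDr !opprD !addrA subrK.
  rewrite mul1r (le_trans (cnormB _ _)) // lerD // cnormZR ger0_norm // usq.
  have := cnormD (u n * (u n - y)) ((u n - y) * y).
  have := cnormM (u n) (u n - y); have := cnormM (u n - y) y.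
  have := ule n; have := eta01 n; have := cnorm_ge0 (u n - y); rewrite /half; nra.
rewrite subr_eq0 => /eqP ey.
have e2 : y + y = x + y * y.
  rewrite {1 2}ey -scalerDl -rmorphD /half.
  by rewrite (_ : 2^-1 + 2^-1 = 1 :> R) ?scale1r //; lra.
exists (1 - y); split.
- by rewrite starB star1 sy.
- by rewrite opprB addrC subrK.
- have yy : y * y = y + y - x by rewrite e2 addrC addKr.
  by rewrite mulrBl mul1r mulrBr mulr1 opprB yy (addrAC _ (- x)) addrK addrA subrK.
- by move=> z zx; apply: commrB; [exact: commr1|exact: comm_y].
Qed.

(** For self-adjoint [h] the norm bound confines the spectrum to [0, 2t]. Stated through the norm,
    positivity is stable under sums by the triangle inequality alone. *)
Definition npositive h := star h = h /\
  exists2 t, 0 <= t & cnorm (t%:C%:A - h) <= t.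

Lemma npositiveD g h : npositive g -> npositive h -> npositive (g + h).
Proof.
move=> [sg [t t0 gt]] [sh [c c0 hc]]; split; first by rewrite starD sg sh.
exists (t + c); first by rewrite addr_ge0.
by rewrite rmorphD scalerDl opprD addrACA (le_trans (cnormD _ _)) // lerD.
Qed.

Lemma npositive_scalar t : 0 <= t -> npositive (t%:C%:A).
Proof.
by move=> t0; split; [exact: star_scalar|exists t => //; rewrite subrr cnorm0].
Qed.

Lemma npositiveZ t h : 0 <= t -> npositive h -> npositive (t%:C *: h).
Proof.
move=> t0 [sh [c c0 hc]]; split; first by rewrite starZR sh.
exists (t * c); first by rewrite mulr_ge0.
by rewrite rmorphM -scalerA -scalerBr cnormZR ger0_norm // ler_wpM2l.
Qed.

Lemma npositive_sqrt h : npositive h ->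
  exists s, [/\ npositive s, s * s = h & forall z, GRing.comm z h -> GRing.comm z s].
Proof.
(* The radius [t] may be 0; enlarging it to [m] permits the rescaling of [h] to [1 - x] with
   [cnorm x <= 1]. *)
move=> [sh [t t0 ht]]; pose m := t + 1; have m0 : 0 < m by rewrite /m; lra.
have hm : cnorm (m%:C%:A - h) <= m.
  rewrite rmorphD rmorph1 scalerDl scale1r addrAC.
  by rewrite (le_trans (cnormD _ _)) // lerD // cnorm1.
have mV : 0 <= m^-1 by rewrite invr_ge0 ltW.
pose x : A := m^-1%:C *: (m%:C%:A - h).
have ex : 1 - x = m^-1%:C *: h.
  by rewrite /x scalerBr scalerA -rmorphM mulVf ?gt_eqF // scale1r opprB addrC subrK.
have [||s [ss s1 s2 cs]] := @sqrt_near1 x.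
- by rewrite /x starZR starB star_scalar sh.
- by rewrite cnormZR ger0_norm // ler_pdivrMl // mulr1.
pose q := Num.sqrt m; have q0 : 0 <= q by rewrite sqrtr_ge0.
exists (q%:C *: s); split.
- split; first by rewrite starZR ss.
  by exists q => //; rewrite -scalerBr cnormZR ger0_norm // ler_piMr.
- rewrite -scalerAl -scalerAr s2 ex !scalerA -!rmorphM -expr2 sqr_sqrtr ?ltW //.
  by rewrite divff ?gt_eqF // scale1r.
- move=> z zh; apply/commZ/cs; apply/commZ/commrB => //; exact: algR_comm.
Qed.

(* [s + i m] is unitary. *)
Lemma circle_cnorm s m : star s = s -> star m = m -> GRing.comm s m ->
  s * s + m * m = 1 -> cnorm s <= 1.
Proof.
move=> ss sm sc e.
pose U : A := s + 'i%C *: m.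
have sU : star U = s - 'i%C *: m.
  by rewrite starD ss starZ sm -scaleNr; congr (_ + _ *: _); simpc.
have U1 : star U * U = 1.
  rewrite sU mulrBl !mulrDr opprD addrA -!scalerAl -!scalerAr -sc addrK.
  by rewrite scalerA -(expr2 'i%C) sqr_i scaleN1r opprK.
have nU : cnorm U = 1.
  have := cnorm_starM U; rewrite U1 cnorm1 => /esym/eqP.
  by rewrite sqrf_eq1 => /orP[/eqP //|/eqP h]; have := cnorm_ge0 U; lra.
have : s + s = U + star U by rewrite sU addrACA subrr addr0.
rewrite -scalec2 => /(congr1 cnorm); rewrite cnormZR ger0_norm // => h.
by have := cnormD U (star U); rewrite cnorm_star -h nU; lra.
Qed.

Lemma circle_cnormR t s m : 0 < t -> star s = s -> star m = m -> GRing.comm s m ->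
  s * s + m * m = t%:C%:A -> cnorm (s * s) <= t.
Proof.
move=> t0 ss sm sc e; pose q := Num.sqrt t.
have q0 : 0 < q by rewrite sqrtr_gt0.
have qq : q^-1 * q^-1 = t^-1 by rewrite -invfM -expr2 sqr_sqrtr ?ltW.
have : cnorm (q^-1%:C *: s) <= 1.
  apply: (@circle_cnorm _ (q^-1%:C *: m)); rewrite ?starZR ?ss ?sm //.
    by apply: commZ; apply: commr_sym; apply: commZ; apply: commr_sym.
  rewrite -!scalerAl -!scalerAr !scalerA -!rmorphM qq -scalerDr e scalerA -rmorphM.
  by rewrite mulVf ?gt_eqF // scale1r.
rewrite cnormZR gtr0_norm ?invr_gt0 // ler_pdivrMl // mulr1 => h.
rewrite -{1}ss cnorm_starM -[leRHS](sqr_sqrtr (ltW t0)) ler_pXn2r //.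
  by rewrite nnegrE cnorm_ge0.
by rewrite nnegrE ltW.
Qed.

(** For [c > 0], [c - k^2] is itself the square of a self-adjoint element, namely [sqrt c] times a
    root of [1 - k^2 / c], and this root commutes with [k]. The circle bound then applies with [k]
    as the second coordinate. *)
Lemma sqr_cnorm_le k c : star k = k -> cnorm (k * k) <= c ->
  cnorm (c%:C%:A - k * k) <= c.
Proof.
move=> sk kc; have := cnorm_ge0 (k * k) => k0.
have [c0|c0] := leP c 0.
  have h : cnorm (k * k) = 0 by lra.
  by rewrite (cnorm_eq0 _ h) subr0 cnorm_scalar ger0_norm //; lra.
have sx : star (c^-1%:C *: (k * k)) = c^-1%:C *: (k * k) by rewrite starZR starM sk.
have [|m [sm _ m2 cm]] := @sqrt_near1 _ sx.
  by rewrite cnormZR gtr0_norm ?invr_gt0 // ler_pdivrMl // mulr1.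
pose q := Num.sqrt c; have qq : q * q = c by rewrite -expr2 sqr_sqrtr ?ltW.
have e : (q%:C *: m) * (q%:C *: m) = c%:C%:A - k * k.
  rewrite -scalerAl -scalerAr scalerA -rmorphM qq m2 scalerBr scalerA -rmorphM.
  by rewrite divff ?gt_eqF // scale1r.
rewrite -e; apply: (@circle_cnormR _ _ k) => //; rewrite ?starZR ?sm //.
  apply: commr_sym; apply/commZ/cm/commZ; exact: commrM.
by rewrite e subrK.
Qed.

Lemma npositive_sqr k : star k = k -> npositive (k * k).
Proof.
move=> sk; split; first by rewrite starM sk.
by exists (cnorm (k * k)); [exact: cnorm_ge0|exact: sqr_cnorm_le].
Qed.

(** The definition provides some radius; since [h] is a square, every radius above its norm
    works. *)
Lemma npositive_le h c : npositive h -> cnorm h <= c -> cnorm (c%:C%:A - h) <= c.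
Proof. by case/npositive_sqrt=> s [[ss _] <- _]; exact: sqr_cnorm_le. Qed.

Lemma npositive_cnorm_le x t : 0 < t -> npositive x -> npositive (t%:C%:A - x) ->
  cnorm x <= t.
Proof.
move=> t0 /npositive_sqrt[s [[ss _] s2 cs]] /npositive_sqrt[m [[sm _] m2 cm]].
rewrite -s2; apply: (@circle_cnormR _ _ m) => //; last by rewrite s2 m2 addrC subrK.
apply: cm; apply: commrB; first exact: algR_comm.
by rewrite -s2; apply: commrM.
Qed.

(** If [x] were nonzero, [cnorm x / 2 - x] would be positive as a sum, forcing
    [cnorm x <= cnorm x / 2]. *)
Lemma npositive_anti x : npositive x -> npositive (- x) -> x = 0.
Proof.
move=> x0 nx; apply: cnorm_eq0; apply/eqP; rewrite eq_le cnorm_ge0 andbT leNgt.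
apply/negP => lt; have t0 : 0 < cnorm x / 2 by lra.
have : npositive ((cnorm x / 2)%:C%:A - x).
  by apply: npositiveD => //; apply: npositive_scalar; exact: ltW.
by move=> /(npositive_cnorm_le t0 x0); lra.
Qed.

(** The radius [cnorm h + 1] serves all shifts of [h] by [d <= 1] at once, so [d] can tend to 0. *)
Lemma npositive_closed h : star h = h ->
  (forall e, 0 < e -> npositive (h + e%:C%:A)) -> npositive h.
Proof.
move=> sh H; split=> //; exists (cnorm h + 1); first by have := cnorm_ge0 h; lra.
apply/ler_addgt0Pr => e e0; pose d := Order.min e 1.
have [d0 de d1] : [/\ 0 < d, d <= e & d <= 1].
  by rewrite /d lt_min e0 ltr01 ge_min lexx ge_min lexx orbT.
have hd : cnorm (h + d%:C%:A) <= cnorm h + 1.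
  by rewrite (le_trans (cnormD _ _)) // lerD // cnorm_scalar gtr0_norm.
have := npositive_le (H d d0) hd.
set k := (_ + 1)%:C%:A => h1.
have : cnorm (k - h) <= cnorm (k - (h + d%:C%:A)) + cnorm (d%:C%:A : A).
  by apply: le_trans (cnormD _ _); rewrite opprD addrA subrK.
by rewrite cnorm_scalar gtr0_norm //; lra.
Qed.

(** With [m = c + t], the element [h + t] is [m] times [1 - (c - h) / m], and [(c - h) / m] has norm
    at most [c / (c + t) < 1]. *)
Lemma npositive_inv h t : npositive h -> 0 < t -> invertible (h + t%:C%:A).
Proof.
move=> [sh [c c0 hc]] t0; pose m := c + t; have m0 : 0 < m by rewrite /m; lra.
have -> : h + t%:C%:A = m%:C *: (1 - m^-1%:C *: (c%:C%:A - h)).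
  rewrite scalerBr scalerA -rmorphM divff ?gt_eqF // scale1r opprB /m rmorphD scalerDl.
  by rewrite [RHS]addrCA (addrC (c%:C%:A)) addrK.
apply: invertibleZ; first by rewrite -(rmorph0 (real_complex R)) (inj_eq (@complexI _)) gt_eqF.
apply: Neumann; rewrite cnormZR gtr0_norm ?invr_gt0 // ltr_pdivrMl // mulr1 /m.
lra.
Qed.

(** For [l = u + iv] with [v] nonzero, [l - h = v (i - k)] with [k] self-adjoint, and [i - k] is a
    factor of the invertible [k^2 + 1]. For real [u < 0], [u - h] is minus a strictly positive shift
    of [h]. *)
Lemma npositive_positive h : npositive h -> positive h.
Proof.
move=> nh; have [sh _] := nh; split=> // -[u v] /= H.
have [v0|v0] := eqVneq v 0; last first.
  exfalso; apply: H; pose k := v^-1%:C *: (h - u%:C%:A).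
  have sk : star k = k by rewrite starZR starB sh star_scalar.
  have -> : (u +i* v)%:A - h = v%:C *: ('i%C%:A - k).
    rewrite scalerBr !scalerA -rmorphM divff // scale1r opprB addrA -scalerDl.
    by congr (_%:A - _); simpc.
  apply: invertibleZ; first by rewrite -(rmorph0 (real_complex R)) (inj_eq (@complexI _)).
  apply: (@invertible_factor _ ((- 'i%C)%:A - k)).
    have -> : ('i%C%:A - k) * ((- 'i%C)%:A - k) = k * k + 1%:C%:A.
      rewrite mulrBl !mulrBr !mulr_algl !mulr_algr scalerA mulrN -(expr2 'i%C) sqr_i.
      by rewrite opprK rmorph1 !scale1r scaleNr opprB opprK addrC -addrA subrKC.
    exact: npositive_inv (npositive_sqr sk) ltr01.
  apply: commrB; first exact: algR_comm.
  by apply: commr_sym; apply: commrB => //; exact: algR_comm.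
move: H; rewrite v0 lecE /= eqxx /= => H; rewrite leNgt; apply/negP => u0; apply: H.
have -> : (u%:C)%:A - h = - (h + (- u)%:C%:A).
  by rewrite rmorphN scaleNr opprB.
apply: invertibleN.
by apply: npositive_inv => //; rewrite oppr_gt0.
Qed.

(** With [j] the inverse of [g] and [d] the inverse of its norm, [g - d = g (1 - d j)]. Both factors
    are positive with commuting roots [s] and [r], so the product is [(s r)^2]. *)
Lemma npositive_invertible g : npositive g -> invertible g ->
  exists2 d, 0 < d & npositive (g - d%:C%:A).
Proof.
move=> ng [j [gj jg]]; have [sg _] := ng.
have [s [[ss _] s2 cs]] := npositive_sqrt ng.
have c0 : 0 < cnorm j.
  rewrite lt_neqAle cnorm_ge0 andbT eq_sym; apply/eqP => /cnorm_eq0 j0.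
  by move: gj; rewrite j0 mulr0 => /esym/eqP; rewrite oner_eq0.
have cV : 0 < (cnorm j)^-1 by rewrite invr_gt0.
set c := cnorm j in c0 cV *.
pose w := 1 - c^-1%:C *: j.
have [|r [[sr _] r2 cr]] := @npositive_sqrt w.
  split; first by rewrite starB star1 starZR (inv_star gj jg).
  exists 1 => //; rewrite scale1r opprB addrC subrK cnormZR gtr0_norm // mulVf //.
  by rewrite gt_eqF.
have sg_comm : GRing.comm s g by rewrite -s2; apply: commrM.
have sr_comm : GRing.comm s r.
  apply: cr; apply: commrB; first exact: commr1.
  by apply/commZ/(inv_comm gj jg).
exists c^-1 => //.
suff -> : g - c^-1%:C%:A = (s * r) * (s * r).
  by apply: npositive_sqr; rewrite starM ss sr sr_comm.
rewrite -mulrA (mulrA r) -sr_comm !mulrA s2 -mulrA r2 mulrBr mulr1.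
by rewrite -scalerAr gj.
Qed.

(** Let [t0] be the least shift making [h] positive in the norm sense. If [t0 > 0], then [- t0] is
    outside the spectrum, so [h + t0] is invertible and some smaller shift already suffices, a
    contradiction. *)
Lemma positive_npositive h : positive h -> npositive h.
Proof.
move=> [sh hsp].
pose S := [set t : R | 0 <= t /\ npositive (h + t%:C%:A)]%classic.
have up t c : npositive (h + t%:C%:A) -> t <= c -> npositive (h + c%:C%:A).
  move=> H tc; rewrite -(subrKC t c) rmorphD scalerDl addrA.
  by apply: npositiveD => //; apply: npositive_scalar; rewrite subr_ge0.
have hS : has_inf S.
  split; last by exists 0 => t [].
  exists (cnorm h); split; first exact: cnorm_ge0.
  split; first by rewrite starD sh star_scalar.
  exists (cnorm h); first exact: cnorm_ge0.
  by rewrite opprD addrCA subrr addr0 cnormN.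
pose t0 := inf S.
have t00 : 0 <= t0 by apply: lb_le_inf; [case: hS|move=> t []].
have nt0 : npositive (h + t0%:C%:A).
  apply: npositive_closed => [|e e0]; first by rewrite starD sh star_scalar.
  have [t [_ nt] tlt] := inf_adherent e0 hS.
  by rewrite -addrA -scalerDl -rmorphD; apply: up nt (ltW tlt).
have [t0P|] := ltP 0 t0; last first.
  by move=> t0'; move: nt0; rewrite (_ : t0 = 0) ?scale0r ?addr0 //; lra.
have [|d d0 nd] := npositive_invertible nt0.
  have -> : h + t0%:C%:A = - ((- t0)%:C%:A - h).
    by rewrite opprB rmorphN scaleNr opprK.
  apply: invertibleN.
  apply: contrapT => /hsp /=; rewrite lecE /= eqxx /=; lra.
pose d' := Order.min d t0.
have [d'0 d'd d't] : [/\ 0 < d', d' <= d & d' <= t0].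
  by rewrite /d' lt_min d0 t0P ge_min lexx ge_min lexx orbT.
have : S (t0 - d').
  split; first by rewrite subr_ge0.
  apply: (@up (t0 - d)); last by lra.
  by rewrite rmorphB scalerBl addrA.
by move=> /(ge_inf hS.2); rewrite -/t0; lra.
Qed.

Lemma positiveP h : positive h <-> npositive h.
Proof. by split; [exact: positive_npositive|exact: npositive_positive]. Qed.

End Positivity.

(** * The absolute value *)

Section AbsoluteValue.
Set Implicit Arguments.
Unset Strict Implicit.
Context {R : realType} {A : cstarAlgType R}.
Implicit Types (a b d p q s x y z : A).

(* [xy] and [yx] have the same nonzero spectrum. *)
Lemma npositive_mulC x y : npositive (x * y) -> star (y * x) = y * x ->
  npositive (y * x).
Proof.
move=> /positiveP[_ hsp] syx; apply/positiveP; split=> // l /= nl; apply: contrapT => l_lt0.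
have [w [h1 h2]] : invertible (l%:A - x * y).
  by apply: contrapT => /hsp /= /l_lt0.
have l0 : l != 0 by apply/eqP => l0; apply: l_lt0; rewrite l0 lexx.
have e1 : (l%:A - y * x) * (1 + y * w * x) = l%:A.
  have -> : (l%:A - y * x) * (1 + y * w * x) =
      l%:A - y * x + y * ((l%:A - x * y) * w) * x.
    rewrite mulrDr mulr1 !mulrBl !mulrBr !mulr_algl mulrBl.
    by rewrite -!scalerAr -!scalerAl !mulrA.
  by rewrite h1 mulr1 subrK.
have e2 : (1 + y * w * x) * (l%:A - y * x) = l%:A.
  have -> : (1 + y * w * x) * (l%:A - y * x) =
      l%:A - y * x + y * (w * (l%:A - x * y)) * x.
    rewrite mulrDl mul1r !mulrBr !mulr_algr mulrBl.
    by rewrite -!scalerAr -!scalerAl !mulrA.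
  by rewrite h2 mulr1 subrK.
apply: nl; exists (l^-1 *: (1 + y * w * x)).
by rewrite -scalerAr -scalerAl e1 e2 scalerA mulVf // scale1r.
Qed.

(** With [u = |h|], the element [d = u - h] is twice the negative part of [h]; the goal is [d = 0].
    For [b = a d], [- b^* b] is a square, so [b b^* = (w^2 + v^2) / 2 - b^* b] is positive.
    Exchanging the factors makes [b^* b] positive too, whence [b = 0]. *)
Lemma npositive_starM a : npositive (star a * a).
Proof.
set h := star a * a.
have sh : star h = h by rewrite /h starM starK.
have [u [nu uu cu]] := npositive_sqrt (npositive_sqr sh).
have [su _] := nu.
have hu : GRing.comm h u by apply: cu; apply: commrM.
pose d := u - h; have sd : star d = d by rewrite starB su sh.
have du : GRing.comm d u by apply/commr_sym/commrB => //; exact: commr_sym.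
have hd : h * d = - (u * d) by rewrite !mulrBr uu hu opprB.
pose b := a * d.
have bb : star b * b = - (u * d * d).
  by rewrite /b starM sd mulrA -(mulrA d) -/h -mulrA hd mulrN mulrA du.
have [r [[sr _] rr cr]] := npositive_sqrt nu.
have rd : GRing.comm r d.
  exact/commr_sym/cr.
have nbb : npositive (- (star b * b)).
  have e : u * d * d = (r * d) * (r * d) by rewrite -rr -(mulrA r) [in LHS]rd !mulrA.
  rewrite bb opprK e.
  by apply: npositive_sqr; rewrite starM sr sd rd.
have nbb' : npositive (b * star b).
  pose w := b + star b; pose v := 'i%C *: (b - star b).
  have sw : star w = w by rewrite starD starK addrC.
  have sv : star v = v.
    by rewrite starZ starB starK -[star b - b]opprB scalerN -scaleNr; congr (_ *: _); simpc.
  have wv : w * w + v * v = 2%:C *: (star b * b + b * star b).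
    rewrite -scalerAl -scalerAr scalerA -(expr2 'i%C) sqr_i scaleN1r.
    rewrite /w !mulrDl !mulrDr !mulrN !mulNr !opprD !opprK addrACA.
    rewrite [X in X + _]addrACA subrr add0r [X in _ + X]addrACA subrr addr0.
    by rewrite scalec2 addrACA [_ + star b * b]addrC.
  have -> : b * star b = (2^-1 : R)%:C *: (w * w + v * v) + - (star b * b).
    rewrite wv scalerA -rmorphM mulVf ?scale1r ?pnatr_eq0 //.
    by rewrite addrAC subrr add0r.
  apply: npositiveD => //; apply: npositiveZ; first by rewrite invr_ge0.
  by apply: npositiveD; apply: npositive_sqr.
have b0 : b = 0.
  apply/star_mul_eq0/npositive_anti => //; apply: npositive_mulC => //.
  by rewrite starM starK.
have hd0 : h * d = 0 by rewrite -mulrA -/b b0 mulr0.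
have d0 : d = 0.
  apply: star_mul_eq0; rewrite sd {1}/d mulrBl hd0 subr0.
  by apply: oppr_inj; rewrite -hd hd0 oppr0.
by move/eqP: d0; rewrite subr_eq0 => /eqP <-.
Qed.

Lemma absAP a : npositive (absA a) /\ absA a * absA a = star a * a.
Proof.
have [s [ns s2 _]] := npositive_sqrt (npositive_starM a).
have [|/positiveP ? ?] := @xgetPex A 0 (fun b => positive b /\ b ^+ 2 = star a * a).
  by exists s; rewrite expr2 s2; split => //; apply/positiveP.
by split => //; rewrite -expr2.
Qed.

(* The defect [z = a |a| - |a^*| a] solves the Sylvester equation
   [|a^*| z = - z |a|], which only has the zero solution of this form. *)
Lemma absA_intertwine a : a * absA a = absA (star a) * a.
Proof.
have [np pp] := absAP a; have [nq] := absAP (star a); rewrite starK => qq.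
set p := absA a in np pp *; set q := absA _ in nq qq *.
have [sp _] := np; have [sq _] := nq.
apply/eqP; rewrite -subr_eq0; apply/eqP; set z := _ - _.
have qz : q * z = - (z * p).
  by rewrite /z mulrBr mulrBl opprB !mulrA qq -(mulrA a p p) pp mulrA.
have sz : star z = p * star a - star a * q by rewrite starB !starM sp sq.
clearbody z; have [s [[ss _] s2 _]] := npositive_sqrt np.
have [t [[st _] t2 _]] := npositive_sqrt nq.
(* The product [z^* z p] is self-adjoint by this identity, and it is positive because exchanging
   factors turns [s z^* z s] into it. So [(t z)^* (t z)] is both positive and negative. *)
have tz : star (t * z) * (t * z) = - (star z * z * p).
  by rewrite starM st -(mulrA (star z) t) (mulrA t t) t2 qz mulrN mulrA.
have tz0 : t * z = 0.
  apply/star_mul_eq0/npositive_anti; first exact: npositive_starM.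
  rewrite tz opprK -s2 mulrA; apply: npositive_mulC.
    have := npositive_starM (z * s); rewrite starM ss.
    by rewrite !mulrA.
  rewrite -mulrA s2 -[_ * p]opprK -tz starN starM starK //.
have qz0 : q * z = 0 by rewrite -t2 -mulrA tz0 mulr0.
have zp0 : z * p = 0 by apply: oppr_inj; rewrite -qz qz0 oppr0.
(* Here the form of [z] enters: each term of [z^* = p a^* - a^* q] is killed by [z p = 0] on the
   left or by [q z = 0] on the right. *)
have zzz : z * (star z * z) = 0.
  rewrite sz mulrBl mulrBr !mulrA zp0 !mul0r sub0r.
  by rewrite -!mulrA qz0 !mulr0 oppr0.
apply/star_mul_eq0/star_mul_eq0.
by rewrite starM starK -mulrA zzz mulr0.
Qed.

End AbsoluteValue.

(** * States *)

Section States.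
Set Implicit Arguments.
Unset Strict Implicit.
Context {R : realType} {A : cstarAlgType R}.
Implicit Types (a h p x y : A) (f : {scalar A}).

Lemma sqr_normc (z : R[i]) : Normc.normc z ^+ 2 = complex.Re z ^+ 2 + complex.Im z ^+ 2.
Proof. by case: z => u v /=; rewrite sqr_sqrtr // addr_ge0 // sqr_ge0. Qed.

Lemma normc_ge0 (z : R[i]) : 0 <= Normc.normc z.
Proof. by case: z => u v /=; exact: sqrtr_ge0. Qed.

Lemma scalar_mul f (l : R[i]) x : f (l *: x) = l * f x.
Proof. exact: linearZ. Qed.

Lemma Re_scalarD f x y :
  complex.Re (f (x + y)) = complex.Re (f x) + complex.Re (f y).
Proof. by rewrite linearD; case: (f x) (f y) => ? ? []. Qed.

Lemma Re_scalarZ f (t : R) x : complex.Re (f (t%:C *: x)) = t * complex.Re (f x).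
Proof. by rewrite scalar_mul; case: (f x) => u v /=; rewrite mul0r subr0. Qed.

Lemma state_le f x : state f -> Normc.normc (f x) <= cnorm x.
Proof.
move=> [_ _ f1].
set S := [set Normc.normc (f y) | y in [set y : A | cnorm y <= 1]]%classic in f1 *.
(* A set without a supremum gets the value 0 from [sup], so a dual norm equal to 1 ensures
   boundedness. *)
have hS : has_sup S.
  by apply: contrapT => /sup_out; rewrite -[sup S]/(dualnorm f) f1 => /eqP; rewrite oner_eq0.
have [x0|x0] := eqVneq (cnorm x) 0; first by rewrite (cnorm_eq0 _ x0) linear0 Normc.normc0 cnorm0.
have xp : 0 < cnorm x by rewrite lt_neqAle eq_sym x0 cnorm_ge0.
have : Normc.normc (f ((cnorm x)^-1%:C *: x)) <= 1.
  rewrite -f1; apply: sup_upper_bound => //; exists ((cnorm x)^-1%:C *: x) => //=.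
  by rewrite cnormZR gtr0_norm ?invr_gt0 // mulVf.
by rewrite scalar_mul Normc.normcM normcR gtr0_norm ?invr_gt0 // ler_pdivrMl // mulr1.
Qed.

(** Shifting [h] by [it] gives [(v + t)^2 <= |h|^2 + t^2], hence [v^2 + 2vt <= |h|^2]. The chosen
    [t] makes [2vt] equal to [|h|^2 + 1]. *)
Lemma state_selfadjoint f h : state f -> star h = h -> complex.Im (f h) = 0.
Proof.
move=> sf sh; have [_ f1 _] := sf.
set v := complex.Im _; apply/eqP/negP => /negP v0.
pose t := (cnorm h ^+ 2 + 1) / (2 * v).
pose x := h + (0 +i* t)%:A.
have fx : f x = (complex.Re (f h) +i* (v + t))%C.
  have -> : f x = f h + (0 +i* t) * 1 by rewrite linearD scalar_mul /= f1.
  by rewrite mulr1 /v; case: (f h) => u w /=; simpc.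
have xx : star x * x = h * h + (t ^+ 2)%:C%:A.
  rewrite starD starZ star1 sh mulrDl !mulrDr !mulr_algl !mulr_algr scalerA.
  have -> : ((0 +i* t)^*)%C = - (0 +i* t)%C :> R[i] by simpc.
  rewrite scaleNr addrA addrK; congr (_ + _%:A); simpc.
  by rewrite expr2.
have := state_le x sf; rewrite -(ler_pXn2r (_ : 0 < 2)%N) ?nnegrE ?normc_ge0 ?cnorm_ge0 //.
rewrite sqr_normc fx -cnorm_starM xx /=.
have := cnormD (h * h) ((t ^+ 2)%:C%:A); rewrite cnorm_scalar ger0_norm ?sqr_ge0 //.
have := cnormM h h; rewrite -expr2.
have e : v * t * 2 = cnorm h ^+ 2 + 1 by rewrite /t; field.
have := sqr_ge0 (complex.Re (f h)); have := sqr_ge0 v.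
rewrite sqrrD; move: e; rewrite -mulr_natr; lra.
Qed.

Lemma state_npositive f h : state f -> npositive h -> 0 <= complex.Re (f h).
Proof.
move=> sf [sh [t t0 ht]]; have [_ f1 _] := sf.
have := le_trans (state_le _ sf) ht.
rewrite linearB scalar_mul f1 mulr1 => ht'.
have {}ht' : `|t - complex.Re (f h)| <= t.
  apply: le_trans ht'; rewrite -normcR le_eqVlt; apply/orP; left; apply/eqP; congr Normc.normc.
  by have := state_selfadjoint sf sh; case: (f h) => u w /= ->; simpc.
by move: ht'; rewrite ler_norml; lra.
Qed.

Lemma state_star f x : state f -> f (star x) = ((f x)^*)%C.
Proof.
move=> sf; have h1 : star (x + star x) = x + star x by rewrite starD starK addrC.
have h2 : star ('i%C *: (x - star x)) = 'i%C *: (x - star x).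
  by rewrite starZ starB starK -[star x - x]opprB scalerN -scaleNr; congr (_ *: _); simpc.
have := state_selfadjoint sf h1; have := state_selfadjoint sf h2.
rewrite scalar_mul linearB linearD /=; case: (f x) (f (star x)) => u v [u' v'] /=.
simpc => /= e1 e2; congr (_ +i* _)%C; lra.
Qed.

Lemma quadratic_discr (a0 b0 n : R) : 0 <= b0 -> 0 <= n ->
  (forall t : R, 0 <= a0 - 2 * t * n + t ^+ 2 * n * b0) -> n <= a0 * b0.
Proof.
move=> b0p n0 H; have [bp|bn] := ltP 0 b0.
  have := H b0^-1; have -> : a0 - 2 * b0^-1 * n + b0^-1 ^+ 2 * n * b0 = a0 - n / b0.
    by field; rewrite gt_eqF.
  by rewrite subr_ge0 ler_pdivrMr.
have -> : b0 = 0 by lra.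
rewrite mulr0 leNgt; apply/negP => np.
have := H ((a0 + 1) / (2 * n)); have -> : b0 = 0 by lra.
have -> : 2 * ((a0 + 1) / (2 * n)) * n = a0 + 1 by field; rewrite gt_eqF.
by rewrite mulr0; lra.
Qed.

Lemma state_CauchySchwarz f x y : state f ->
  Normc.normc (f (star x * y)) ^+ 2 <=
  complex.Re (f (star x * x)) * complex.Re (f (star y * y)).
Proof.
move=> sf.
apply: quadratic_discr; rewrite ?sqr_ge0 //; first exact/(state_npositive sf)/npositive_starM.
move=> t; set w := f (star x * y).
have e : f (star y * x) = (w^*)%C by rewrite -state_star // starM starK.
(* The factor [w^*] aligns the phases, so positivity of [f(z^* z)] becomes a real quadratic in [t]
   whose last two coefficients both carry [|w|^2]. *)
pose c := t%:C * (w^*)%C; pose z := x - c *: y.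
have := state_npositive sf (npositive_starM z).
have -> : star z * z = star x * x - c *: (star x * y) - (c^*)%C *: (star y * x)
                      + ((c^*)%C * c) *: (star y * y).
  rewrite /z starB starZ mulrBl !mulrBr -!scalerAl -!scalerAr scalerA opprB addrA.
  by rewrite addrAC.
have r1 := state_selfadjoint sf (npositive_starM y).1.
rewrite linearD !linearB !scalar_mul /= e -/w sqr_normc /c.
move: r1; clear e z c; clearbody w; case: (f (star y * y)) => d1 d2 /= ->.
case: (f (star x * x)) => a1 a2; case: w => w1 w2 /=.
simpc => /=; lra.
Qed.

Lemma state_absA f a : state f ->
  Normc.normc (f a) ^+ 2 <= complex.Re (f (absA (star a))) * complex.Re (f (absA a)).
Proof.
move=> sf; have [_ f1 _] := sf.
have ap := absA_intertwine a.
have [np _] := absAP a; have [nq] := absAP (star a); rewrite starK => qq.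
set p := absA a in ap np *; set q := absA _ in ap nq qq *.
have [sq _] := nq.
have P0 := state_npositive sf np; have Q0 := state_npositive sf nq.
have main e : 0 < e ->
    Normc.normc (f a) ^+ 2 <= complex.Re (f q) * (complex.Re (f p) + e).
  move=> e0; have [j [ej je]] := npositive_inv np e0.
  have [i [gi ig]] := npositive_inv nq e0.
  set E := p + _ in ej je; set G := q + _ in gi ig.
  have nE : npositive E by apply: npositiveD => //; apply: npositive_scalar; exact: ltW.
  have nG : npositive G by apply: npositiveD => //; apply: npositive_scalar; exact: ltW.
  have sj := inv_star ej je nE.1; have si := inv_star gi ig nG.1.
  have [k [[sk _] kk _]] := npositive_sqrt nE.
  have kj : GRing.comm k j by apply: inv_comm ej je _; rewrite -kk; apply: commrM.
  have ia : i * a = a * j.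
    have aE : a * E = G * a by rewrite mulrDr mulrDl ap mulr_algl mulr_algr.
    by rewrite -[LHS]mulr1 -ej mulrA -(mulrA i) aE mulrA ig mul1r.
  pose n := k * j.
  have sn : star n = n by rewrite starM sj sk -kj.
  have nk : n * k = 1 by rewrite /n kj -mulrA kk.
  (* Thus [n] is [(p + e)^(-1/2)]. Cauchy-Schwarz for [a = (a n) k] produces
     [a j a^* = i a a^* = i q^2] as the first factor. *)
  have nn : n * n = j by rewrite {2}/n mulrA nk mul1r.
  have := state_CauchySchwarz (star (a * n)) k sf.
  rewrite starK -mulrA nk mulr1 starM sn sk kk mulrA -(mulrA a) nn -ia -mulrA -qq.
  have -> : complex.Re (f E) = complex.Re (f p) + e.
    by rewrite Re_scalarD Re_scalarZ f1 mulr1.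
  move/le_trans; apply; rewrite ler_wpM2r ?addr_ge0 ?(ltW e0) //.
  have [t [[st _] tt _]] := npositive_sqrt nq.
  (* It remains to see [f(i q^2) <= f(q)]. The difference [q - i q^2] equals [e i q], and this
     identity shows that [i q] is positive. *)
  have iq : i * q = star (q * i) * (q * i) + e%:C *: (star (t * i) * (t * i)).
    rewrite -[LHS]mulr1 -gi /G mulrDl mulrDr mulr_algl -scalerAr !starM sq st si.
    by rewrite -(mulrA i t) (mulrA t t) tt !mulrA.
  have diff : q = i * (q * q) + e%:C *: (i * q).
    by rewrite scalerAr -mulrDr -[e%:C *: q]mulr_algl -mulrDl mulrA ig mul1r.
  have := state_npositive sf (npositive_starM (q * i)).
  have := state_npositive sf (npositive_starM (t * i)).
  have := congr1 (fun x => complex.Re (f x)) diff.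
  have := congr1 (fun x => complex.Re (f x)) iq.
  rewrite /= !Re_scalarD !Re_scalarZ => -> -> h1 h2.
  by rewrite lerDl mulr_ge0 ?(ltW e0) // addr_ge0 // mulr_ge0 // ltW.
have [Q1|Q1] := eqVneq (complex.Re (f q)) 0.
  by have := main 1 ltr01; rewrite Q1 !mul0r.
apply/ler_addgt0Pr => e e0.
have Qp : 0 < complex.Re (f q) by rewrite lt_neqAle eq_sym Q1.
have := main (e / complex.Re (f q)); rewrite divr_gt0 // mulrDr [X in _ + X]mulrCA divff //.
by rewrite mulr1; apply.
Qed.

Lemma state_power f p r : state f -> npositive p ->
  complex.Re (f p) ^+ r <= complex.Re (f (p ^+ r)).
Proof.
move=> sf np; have [_ f1 _] := sf; have [s [[ss _] s2 _]] := npositive_sqrt np.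
pose m n := complex.Re (f (p ^+ n)).
have pX n : p ^+ n = star (s ^+ n) * s ^+ n.
  by rewrite starX ss -exprMn_comm // s2.
have m0 n : 0 <= m n.
  by apply/(state_npositive sf); rewrite pX; exact: npositive_starM.
have mm n : m n.+1 ^+ 2 <= m n * m n.+2.
  have := state_CauchySchwarz (s ^+ n) (s ^+ n.+2) sf.
  rewrite -!pX [X in star X]/= starX ss -exprD.
  rewrite (_ : n + n.+2 = n.+1 + n.+1)%N; last by rewrite !addnS.
  rewrite exprD -{1}ss -starX -pX sqr_normc -/(m n) -/(m n.+2) -/(m n.+1).
  have := sqr_ge0 (complex.Im (f (p ^+ n.+1))); lra.
(* Log-convexity makes the ratios [m n.+1 / m n] nondecreasing, and the first one is [m 1] since
   [m 0 = 1]. Vanishing moments are treated apart. *)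
have mS n : m 1%N * m n <= m n.+1.
  elim: n => [|n IH]; first by rewrite /m expr0 f1 mulr1.
  have := mm n; have := m0 n; have := m0 n.+1; have := m0 n.+2; have := m0 1%N.
  rewrite le_eqVlt => /orP[/eqP <-|m1]; first by rewrite mul0r.
  rewrite [0 <= m n.+1]le_eqVlt => + /orP[/eqP <-|mn]; first by rewrite mulr0.
  move=> h2 h0 h; rewrite -(ler_pM2r mn).
  apply: le_trans (_ : m n.+2 * (m 1%N * m n) <= _); last first.
    by rewrite ler_wpM2l.
  by rewrite -mulrA -expr2; nra.
rewrite -[complex.Re (f p)]/(m 1%N) -/(m r).
elim: r => [|r IH]; first by rewrite expr0 /m expr0 f1.
by rewrite exprS; apply: le_trans (mS r); rewrite ler_wpM2l.
Qed.

End States.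

(** * Norm estimates *)

Section NormOfSum.
Set Implicit Arguments.
Unset Strict Implicit.
Context {R : realType} {A : cstarAlgType R}.
Implicit Types (a h s t : A).

Lemma Bernoulli (x : R) n : -1 <= x -> 1 + n%:R * x <= (1 + x) ^+ n.
Proof.
move=> x1; elim: n => [|n IH]; first by rewrite mul0r addr0 expr0.
rewrite exprS; apply: le_trans (ler_wpM2l _ IH); last lra.
have := mulr_ge0 (ler0n R n) (sqr_ge0 x); rewrite -natr1; lra.
Qed.

(** When [y > 0], the powers of [x / y] along the exponents [2 ^ n] stay below [C / y], whereas a
    ratio above 1 would make them unbounded by Bernoulli. This replaces taking roots in
    spectral-radius arguments. *)
Lemma le_of_powers (x y C : R) : 0 <= x -> 0 <= y ->
  (forall n, x ^+ (2 ^ n) <= C * y ^+ (2 ^ n).-1) -> x <= y.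
Proof.
move=> x0 y0 H; rewrite leNgt; apply/negP => yx.
have [yp|yn] := ltP 0 y; last first.
  have y00 : y = 0 by lra.
  by have := H 1%N; rewrite y00 expr1 mulr0 expr2; nra.
pose r := x / y - 1; have r0 : 0 < r by rewrite subr_gt0 ltr_pdivlMr // mul1r.
have bd n : (1 + r) ^+ (2 ^ n) <= C / y.
  have -> : 1 + r = x / y by rewrite /r; lra.
  rewrite expr_div_n ler_pdivrMr ?exprn_gt0 // (le_trans (H n)) //.
  by rewrite -{2}(prednK (expn_gt0 2 n)) exprS -mulrA mulKf ?gt_eqF.
have := archi_boundP (_ : 0 <= `|C / y| / r).
set N := Num.bound _; rewrite divr_ge0 ?(ltW r0) // ltr_pdivrMr // => /(_ isT) hN.
have := bd N; have := Bernoulli (2 ^ N) (_ : -1 <= r);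
rewrite (_ : -1 <= r) => [/(_ isT)|]; last lra.
have : N%:R * r <= (2 ^ N)%:R * r by rewrite ler_wpM2r ?(ltW r0) // ler_nat ltnW // ltn_expl.
have := ler_norm (C / y); lra.
Qed.

Lemma cnorm_pow2 h n : star h = h -> cnorm (h ^+ (2 ^ n)) = cnorm h ^+ (2 ^ n).
Proof.
move=> sh; elim: n => [|n IH]; first by rewrite !expr1.
by rewrite expnSr !exprM expr2 -{1}[h]sh -starX cnorm_starM IH.
Qed.

(** Multiplying by [h] acts on the pair [(s h^n, t h^n)] through the matrix with rows [(s s, s t)]
    and [(t s, t t)], whose rows have norm sums at most [c + d]. So [h^n] grows at most like
    [(c + d)^n], and for self-adjoint [h] this bounds the norm. *)
Lemma cnorm_add_sqr s t (c d : R) : star s = s -> star t = t ->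
  cnorm (s * s) <= c -> cnorm (t * t) <= c -> cnorm (s * t) <= d ->
  cnorm (s * s + t * t) <= c + d.
Proof.
move=> ss st sc tc std; set h := _ + _.
have sh : star h = h by rewrite starD !starM ss st.
have tsd : cnorm (t * s) <= d by rewrite -cnorm_star starM ss st.
have c0 : 0 <= c := le_trans (cnorm_ge0 _) sc.
have d0 : 0 <= d := le_trans (cnorm_ge0 _) std.
pose K := cnorm s + cnorm t; have := cnorm_ge0 s; have := cnorm_ge0 t => t0 s0.
have step n : cnorm (s * h ^+ n) <= K * (c + d) ^+ n /\
              cnorm (t * h ^+ n) <= K * (c + d) ^+ n.
  elim: n => [|n [IHs IHt]]; first by rewrite !expr0 !mulr1 /K; split; lra.
  rewrite !exprS mulrCA (mulrDl c).
  have expand u : u * (h * h ^+ n) = u * s * (s * h ^+ n) + u * t * (t * h ^+ n).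
    by rewrite /h mulrDl mulrDr !mulrA.
  rewrite !expand; split; apply: le_trans (cnormD _ _) _;
    [|rewrite [leRHS]addrC]; apply: lerD; apply: le_trans (cnormM _ _) _;
    by apply: ler_pM; rewrite ?cnorm_ge0.
apply: (@le_of_powers _ _ (K * K)); rewrite ?cnorm_ge0 ?addr_ge0 // => n.
rewrite -cnorm_pow2 //; case: (2 ^ n)%N (expn_gt0 2 n) => // m _.
have [hs ht] := step m; rewrite /= exprS {1}/h mulrDl -!mulrA.
apply: le_trans (cnormD _ _) _; rewrite /K mulrDl -/K.
by apply: lerD; apply: le_trans (cnormM _ _) _; rewrite ler_wpM2l.
Qed.

(** By the C*-identity the left side is the norm of [v = t s^2 t]. Regrouping a power of [v] exposes
    a power of [t^2 s^2] between fixed outer factors, which disappear asymptotically. *)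
Lemma cnorm_mul_sqr_le s t : star s = s -> star t = t ->
  cnorm (s * t) ^+ 2 <= cnorm (t * t * (s * s)).
Proof.
move=> ss st; rewrite -cnorm_starM starM ss st; set v := t * s * (s * t).
have sv : star v = v by rewrite !starM ss st.
have vX m : v ^+ m.+1 = t * (s * s) * (t * t * (s * s)) ^+ m * t.
  elim: m => [|m IH]; first by rewrite expr0 expr1 mulr1 /v !mulrA.
  by rewrite exprSr IH exprSr /v !mulrA.
apply: (@le_of_powers _ _ (cnorm (t * (s * s)) * cnorm t)); rewrite ?cnorm_ge0 // => n.
rewrite -cnorm_pow2 //; case: (2 ^ n)%N (expn_gt0 2 n) => // m _.
rewrite vX /= mulrAC; apply: le_trans (cnormM _ _) _; rewrite ler_wpM2r ?cnorm_ge0 //.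
by apply: le_trans (cnormM _ _) _; rewrite ler_wpM2l ?cnorm_ge0 ?cnormX.
Qed.

Lemma cnorm_absA a : cnorm (absA a) = cnorm a.
Proof.
have [[sp _] pp] := absAP a; apply/eqP.
by rewrite -(@eqrXn2 _ 2) ?cnorm_ge0 // -!cnorm_starM sp pp.
Qed.

(** Two uses of the C*-identity trade [p^2] for [a^* a] and then [q^2] for [a a^*]. *)
Lemma cnorm_absA_mul a : cnorm (absA (star a) * absA a) = cnorm (a * a).
Proof.
have [[sp _] pp] := absAP a; have [[sq _]] := absAP (star a); rewrite starK => qq.
set p := absA a in sp pp *; set q := absA _ in sq qq *.
apply/eqP; rewrite -(@eqrXn2 _ 2) ?cnorm_ge0 //; apply/eqP.
rewrite -!cnorm_mulstar !starM sp sq -mulrA (mulrA p) pp.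
have -> : q * (star a * a * q) = star (a * q) * (a * q) by rewrite starM sq !mulrA.
by rewrite cnorm_starM -cnorm_mulstar starM sq -mulrA (mulrA q) qq !mulrA.
Qed.

Lemma cnorm_absA_add a :
  cnorm (absA a + absA (star a)) <= cnorm a + Num.sqrt (cnorm (a ^+ 2)).
Proof.
have [s [[ss _] s2 _]] := npositive_sqrt (absAP a).1.
have [t [[st _] t2 _]] := npositive_sqrt (absAP (star a)).1.
rewrite -s2 -t2; apply: cnorm_add_sqr => //.
- by rewrite s2 cnorm_absA.
- by rewrite t2 cnorm_absA cnorm_star.
rewrite -(ger0_norm (cnorm_ge0 (s * t))) -sqrtr_sqr ler_wsqrtr //.
by rewrite expr2 -cnorm_absA_mul -s2 -t2; apply: cnorm_mul_sqr_le.
Qed.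

Lemma sup_power_le (S : set R) (C : R) r : (0 < r)%N -> 0 <= C ->
  (forall x, S x -> 0 <= x /\ x ^+ r <= C) -> sup S ^+ r <= C.
Proof.
move=> r0 C0 HS; rewrite leNgt; apply/negP => lt.
(* Without a supremum [sup S] is 0, and [0 ^+ r = 0] because [r > 0]. *)
have hS : has_sup S.
  apply: contrapT => /sup_out e; move: lt; rewrite e expr0n; case: r r0 HS => //= r _ _.
  by lra.
have [x0 Sx0] := hS.1.
have v0 : 0 <= sup S := le_trans (HS _ Sx0).1 (sup_upper_bound hS Sx0).
have vr : 0 < sup S ^+ r by lra.
(* The slack [d] satisfies [1 - r d = c], so Bernoulli gives [(v (1 - d))^r >= c v^r = C]; an
   element of [S] above [v (1 - d)] then violates its bound. *)
pose v := sup S; pose c := C / v ^+ r; pose d := (1 - c) / r%:R.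
have vp : 0 < v.
  rewrite lt_neqAle v0 andbT eq_sym; apply/eqP => e.
  by move: vr; rewrite -/v e expr0n gtn_eqF // ltxx.
have c0 : 0 <= c by rewrite divr_ge0 // ltW.
have c1 : c < 1 by rewrite ltr_pdivrMr // mul1r.
have rp : 1 <= r%:R :> R by rewrite ler1n.
have rd : r%:R * d = 1 - c by rewrite /d mulrCA divff ?mulr1 // gt_eqF //; lra.
have d0 : 0 < d by rewrite divr_gt0; lra.
have d1 : d <= 1 by nra.
have vd0 : 0 < v * d by rewrite mulr_gt0.
have [x Sx] := sup_adherent vd0 hS; rewrite -/v => vx.
have [x0' xC] := HS _ Sx.
have w0 : 0 <= v * (1 - d) by rewrite mulr_ge0 ?(ltW vp) // subr_ge0.
have : (v * (1 - d)) ^+ r < x ^+ r by rewrite ltrXn2r -?lt0n //; lra.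
have := Bernoulli r (_ : -1 <= - d); rewrite mulrN rd => B.
have : C <= (v * (1 - d)) ^+ r.
  rewrite exprMn -ler_pdivrMl // mulrC -/c; apply: le_trans (B _); lra.
lra.
Qed.

End NormOfSum.

(** * Bounds for states and for the numerical radius *)

Theorem theorem3p3 (R : realType) (A : cstarAlgType R) (a : A) :
  [/\ forall f : {scalar A}, state f -> forall r : nat, (0 < r)%N ->
        `|f a| ^+ r <= 2^-1 * f (absA a ^+ r + absA (star a) ^+ r),
      forall r : nat, (0 < r)%N ->
        numradius a ^+ r <= 2^-1 * cnorm (absA a ^+ r + absA (star a) ^+ r),
      numradius a <= 2^-1 * cnorm (absA a + absA (star a)) &
      2^-1 * cnorm (absA a + absA (star a)) <=
        2^-1 * cnorm a + 2^-1 * Num.sqrt (cnorm (a ^+ 2))].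
Proof.
have [np _] := absAP a; have [nq _] := absAP (star a).
have part1 (f : {scalar A}) (r : nat) : state f -> Normc.normc (f a) ^+ r <=
    2^-1 * complex.Re (f (absA a ^+ r + absA (star a) ^+ r)).
  move=> sf; rewrite Re_scalarD.
  have := state_power r sf np; have := state_power r sf nq.
  have := state_absA a sf.
  have := state_npositive sf np; have := state_npositive sf nq.
  set P := complex.Re (f (absA a)); set Q := complex.Re (f (absA (star a))).
  set N := Normc.normc _ => Q0 P0 NPQ Qr Pr.
  (* AM-GM in squared form: [N^(2r) <= P^r Q^r], which is at most the square of the mean of [P^r]
     and [Q^r]. *)
  have : N ^+ r <= 2^-1 * (P ^+ r + Q ^+ r).
    rewrite -(@ler_pXn2r _ 2) ?nnegrE ?exprn_ge0 ?normc_ge0 //; last first.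
      by apply: mulr_ge0; [rewrite invr_ge0|apply: addr_ge0; exact: exprn_ge0].
    rewrite -exprM mulnC exprM.
    have : (N ^+ 2) ^+ r <= Q ^+ r * P ^+ r by rewrite -exprMn lerXn2r ?nnegrE ?sqr_ge0 ?mulr_ge0.
    have := sqr_ge0 (P ^+ r - Q ^+ r); lra.
  lra.
have part2 r : (0 < r)%N ->
    numradius a ^+ r <= 2^-1 * cnorm (absA a ^+ r + absA (star a) ^+ r).
  move=> r0; apply: sup_power_le; rewrite ?mulr_ge0 ?invr_ge0 ?cnorm_ge0 //.
  move=> _ [f sf <-]; split; first exact: normc_ge0.
  apply: le_trans (part1 f r sf) _; apply: ler_wpM2l; first by rewrite invr_ge0.
  apply: le_trans (state_le _ sf); case: (f _) => u v /=.
  by apply: le_trans (ler_norm u) _; rewrite -sqrtr_sqr ler_wsqrtr // lerDl sqr_ge0.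
split => //.
- move=> f sf r r0; have := part1 f r sf.
  (* The order on [R[i]] compares only numbers with equal imaginary parts, so the value of [f] must
     be shown real. *)
  have s1 : star (absA a ^+ r + absA (star a) ^+ r) = absA a ^+ r + absA (star a) ^+ r.
    by rewrite starD !starX np.1 nq.1.
  have := state_selfadjoint sf s1; case: (f (_ + _)) => u v /= ->.
  have -> : `|f a| = (Normc.normc (f a))%:C by [].
  by rewrite complexr0 -(rmorph_nat (real_complex R)) -fmorphV -rmorphXn -rmorphM lecR.
- by have := part2 1%N isT; rewrite !expr1.
- rewrite -mulrDr; apply: ler_wpM2l; first by rewrite invr_ge0.
  exact: cnorm_absA_add.
Qed.
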